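(* For every $n\ge 1$, on the monoid $\mathcal{DORP}_n$ Green's relations satisfy $\mathcal{H}=\mathcal{R}$.
   Context: Let $[n]=\{1,\dots,n\}$ with its usual order. A partial transformation of $[n]$ is a function $\rho$ whose domain $\mathrm{Dom}\,\rho$ and image $\mathrm{Im}\,\rho$ are subsets of $[n]$ (the empty map is allowed). Maps are written on the right and composed left to right: $x(\rho\sigma)=(x\rho)\sigma$. $\rho$ is isotone if $x\le y$ implies $x\rho\le y\rho$ for all $x,y\in\mathrm{Dom}\,\rho$; antitone if $x\le y$ implies $x\rho\ge y\rho$; monotone if isotone or antitone; decreasing if $x\rho\le x$ for all $x\in\mathrm{Dom}\,\rho$. $\mathcal{DORP}_n$ is the monoid, under composition, of all monotone and decreasing partial transformations of $[n]$. Green's relations on a semigroup $S$: $g\,\mathcal{L}\,h$ iff $S^1g=S^1h$; $g\,\mathcal{R}\,h$ iff $gS^1=hS^1$; $\mathcal{H}=\mathcal{L}\cap\mathcal{R}$. *)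

(* Defs.v *)
From HB Require Import structures.
From mathcomp Require Import all_boot.
From mathcomp Require Import boolp classical_sets.

Set Implicit Arguments.
Unset Strict Implicit.
Unset Printing Implicit Defensive.

Local Open Scope classical_set_scope.
Local Open Scope group_scope.

Section Green.
Variable S : semigroupType.
Implicit Types g h : S.

(* S^1 g and g S^1. When S has an identity, S^1 = S and the disjunct
   x = g is redundant. *)
Definition lideal1 g : set S := [set x | x = g \/ exists s, x = s * g].
Definition rideal1 g : set S := [set x | x = g \/ exists s, x = g * s].

Definition greenL : set (S * S) := [set p | lideal1 p.1 = lideal1 p.2].
Definition greenR : set (S * S) := [set p | rideal1 p.1 = rideal1 p.2].
Definition greenH : set (S * S) := greenL `&` greenR.

End Green.

Arguments greenL : clear implicits.
Arguments greenR : clear implicits.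
Arguments greenH : clear implicits.

(* The chain [n] = {1 < ... < n} is represented by 'I_n = {0 < ... < n-1};
   r x = None means that x is outside Dom r. *)
Record ptrans n := PTrans { pfun :> {ffun 'I_n -> option 'I_n} }.

HB.instance Definition _ n := [isNew for @pfun n].
HB.instance Definition _ n := [Finite of ptrans n by <:].

Section PartialTransformations.
Variable n : nat.
Implicit Types r s : ptrans n.

(* Maps act on the right: x (r s) = (x r) s, so r is applied first. *)
Definition ptrans_mul r s : ptrans n := PTrans [ffun x => obind s (r x)].
Definition ptrans_one : ptrans n := PTrans [ffun x => Some x].

Lemma ptransP r s : r =1 s -> r = s.
Proof. by move=> rs; apply/val_inj/ffunP. Qed.

Lemma ptrans_mulA : associative ptrans_mul.
Proof.
move=> r s t; apply: ptransP => x; rewrite !ffunE.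
by case: (r x) => //= y; rewrite ffunE.
Qed.

Lemma ptrans_mul1 : left_id ptrans_one ptrans_mul.
Proof. by move=> r; apply: ptransP => x; rewrite !ffunE. Qed.

Lemma ptrans_mulr1 : right_id ptrans_one ptrans_mul.
Proof.
move=> r; apply: ptransP => x; rewrite ffunE.
by case: (r x) => //= y; rewrite ffunE.
Qed.

HB.instance Definition _ :=
  isMonoid.Build (ptrans n) ptrans_mulA ptrans_mul1 ptrans_mulr1.

Definition isotone r : bool :=
  [forall x, forall y, forall a, forall b,
    [&& r x == Some a, r y == Some b & x <= y] ==> (a <= b)].

Definition antitone r : bool :=
  [forall x, forall y, forall a, forall b,
    [&& r x == Some a, r y == Some b & x <= y] ==> (b <= a)].

Definition monotone r : bool := isotone r || antitone r.

Definition decreasing r : bool :=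
  [forall x, forall a, (r x == Some a) ==> (a <= x)].

Definition dorp : pred (ptrans n) := fun r => monotone r && decreasing r.

Lemma isotoneP r : reflect (forall x y a b : 'I_n,
  r x = Some a -> r y = Some b -> x <= y -> a <= b) (isotone r).
Proof.
apply: (iffP idP) => [H x y a b xa yb xy | H].
  by move/forallP/(_ x)/forallP/(_ y)/forallP/(_ a)/forallP/(_ b): H;
     rewrite xa yb !eqxx xy.
apply/forallP => x; apply/forallP => y; apply/forallP => a; apply/forallP => b.
by apply/implyP => /and3P[/eqP xa /eqP yb xy]; apply: H xy.
Qed.

Lemma antitoneP r : reflect (forall x y a b : 'I_n,
  r x = Some a -> r y = Some b -> x <= y -> b <= a) (antitone r).
Proof.
apply: (iffP idP) => [H x y a b xa yb xy | H].
  by move/forallP/(_ x)/forallP/(_ y)/forallP/(_ a)/forallP/(_ b): H;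
     rewrite xa yb !eqxx xy.
apply/forallP => x; apply/forallP => y; apply/forallP => a; apply/forallP => b.
by apply/implyP => /and3P[/eqP xa /eqP yb xy]; apply: H xy.
Qed.

Lemma decreasingP r :
  reflect (forall x a : 'I_n, r x = Some a -> a <= x) (decreasing r).
Proof.
apply: (iffP idP) => [H x a xa | H].
  by move/forallP/(_ x)/forallP/(_ a): H; rewrite xa eqxx.
by apply/forallP => x; apply/forallP => a; apply/implyP => /eqP/H.
Qed.

Lemma ptrans_mulE r s x c : (r * s) x = Some c ->
  exists2 b, r x = Some b & s b = Some c.
Proof. by rewrite ffunE; case: (r x) => //= b; exists b. Qed.

Lemma dorp_closed : monoid_closed dorp.
Proof.
split=> [|r s].
  apply/andP; split; [apply/orP; left; apply/isotoneP | apply/decreasingP].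
    by move=> x y a b; rewrite !ffunE => -[->] [->].
  by move=> x a; rewrite ffunE => -[->].
case/andP=> mr /decreasingP dr /andP[ms /decreasingP ds].
apply/andP; split; last first.
  apply/decreasingP => x c /ptrans_mulE[b xb bc].
  exact: leq_trans (ds _ _ bc) (dr _ _ xb).
case/orP: mr ms => [/isotoneP ir|/antitoneP ar];
  case/orP=> [/isotoneP is_|/antitoneP as_].
- apply/orP; left; apply/isotoneP => x y a b.
  move=> /ptrans_mulE[x' xx x'a] /ptrans_mulE[y' yy y'b] xy.
  exact: is_ x'a y'b (ir _ _ _ _ xx yy xy).
- apply/orP; right; apply/antitoneP => x y a b.
  move=> /ptrans_mulE[x' xx x'a] /ptrans_mulE[y' yy y'b] xy.
  exact: as_ x'a y'b (ir _ _ _ _ xx yy xy).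
- apply/orP; right; apply/antitoneP => x y a b.
  move=> /ptrans_mulE[x' xx x'a] /ptrans_mulE[y' yy y'b] xy.
  exact: is_ y'b x'a (ar _ _ _ _ xx yy xy).
- apply/orP; left; apply/isotoneP => x y a b.
  move=> /ptrans_mulE[x' xx x'a] /ptrans_mulE[y' yy y'b] xy.
  exact: as_ y'b x'a (ar _ _ _ _ xx yy xy).
Qed.

End PartialTransformations.

Record DORP n := MkDORP { dorp_val :> ptrans n; dorpP : dorp dorp_val }.

HB.instance Definition _ n := [isSub for @dorp_val n].
HB.instance Definition _ n := [Finite of DORP n by <:].
HB.instance Definition _ n :=
  SubChoice_isSubMonoid.Build (ptrans n) (@dorp n) (DORP n) (@dorp_closed n).

(* Main.v *)
(** Right multiplication by a decreasing map can only shrink the domain and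
    lower the values. Two [R]-related elements are therefore below each other
    pointwise, hence equal: [R] is the identity relation, and so is [H]. *)
Require Import Defs.
From HB Require Import structures.
From mathcomp Require Import all_boot.
From mathcomp Require Import boolp classical_sets.

Lemma rideal1_refl (S : semigroupType) (g : S) : rideal1 g g.
Proof. by left. Qed.

Lemma rideal1_dorp_le {n} {g h : DORP n} {x a : 'I_n} :
  rideal1 h g -> g x = Some a -> exists2 b, h x = Some b & a <= b.
Proof.
case=> [->|[s ->]]; first by exists a.
case/(@ptrans_mulE n h s) => b hx sb; exists b => //.
by have /andP[_ /decreasingP] := dorpP s; apply.
Qed.

Lemma rideal1_dorp_anti {n} {g h : DORP n} :
  rideal1 h g -> rideal1 g h -> g = h.
Proof.
move=> hg gh; apply/val_inj/ptransP => x.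
case gx: (g x) => [a|].
  have [b hx ab] := rideal1_dorp_le hg gx.
  have [c] := rideal1_dorp_le gh hx; rewrite gx => -[<-] ba.
  by rewrite hx; congr Some; apply/val_inj/anti_leq; rewrite ab ba.
case hx: (h x) => [b|//].
by have [c] := rideal1_dorp_le gh hx; rewrite gx.
Qed.

Lemma greenR_dorp_eq {n} {g h : DORP n} : greenR (DORP n) (g, h) -> g = h.
Proof.
rewrite /greenR /= => gRh.
apply: rideal1_dorp_anti; first by rewrite -gRh; apply: rideal1_refl.
by rewrite gRh; apply: rideal1_refl.
Qed.

Theorem corollary2p3 (n : nat) (hn : 1 <= n) :
  greenH (DORP n) = greenR (DORP n).
Proof.
apply/seteqP; split=> [p [] // | [g h] gRh].
by split=> //; rewrite (greenR_dorp_eq gRh).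
Qed.
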